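(* Let $G$ be a spanning subgraph of a graph $H$ and let $i\in V(G)$. Suppose $A\in\mathcal{S}(G)$ has the $i$-SNIP. Then for every $\varepsilon>0$ there is a matrix $A'\in\mathcal{S}(H)$ with $\|A'-A\|<\varepsilon$ such that $A$ and $A'$ have the same $i$-nullity pair and $A'$ has the $i$-SNIP.
   Context: All matrices are real. For a simple graph $G$ on $[n]$, $\mathcal{S}(G)$ is the set of real symmetric $n\times n$ matrices whose off-diagonal $(j,k)$ entry is nonzero iff $\{j,k\}\in E(G)$ (diagonal free). $A(i)$ is $A$ with row and column $i$ deleted; the $i$-nullity pair of $A$ is $(\operatorname{null}(A),\operatorname{null}(A(i)))$. $A$ has the $i$-SNIP if $X=O$ is the only real symmetric $X$ with $A\circ X=O$, $I\circ X=O$ and $(AX)(i,:]=O$ ($AX$ with row $i$ deleted). $\|\cdot\|$ is any matrix norm. *)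

(* Defs.v *)
From mathcomp Require Import all_boot all_order all_algebra.
From mathcomp Require Import reals.

Set Implicit Arguments.
Unset Strict Implicit.
Unset Printing Implicit Defensive.

Import Order.TTheory GRing.Theory Num.Theory.
Local Open Scope ring_scope.

Record simple_graph (n : nat) := SimpleGraph {
  adj : rel 'I_n;
  adj_sym : symmetric adj;
  adj_irrefl : irreflexive adj
}.

Definition spanning_subgraph (n : nat) (G H : simple_graph n) : Prop :=
  subrel (adj G) (adj H).

Definition symmetric_mx (R : realType) (n : nat) (A : 'M[R]_n) : Prop :=
  A^T = A.

Definition graph_matrices (R : realType) (n : nat) (G : simple_graph n)
    (A : 'M[R]_n) : Prop :=
  symmetric_mx A /\
  forall j k : 'I_n, j != k -> (A j k <> 0 <-> adj G j k).

Definition hadamard (R : realType) (m n : nat) (A B : 'M[R]_(m, n)) :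
    'M[R]_(m, n) := map2_mx *%R A B.

(* The column space of [cokermx A] is the null space {v | A *m v = 0}. *)
Definition nullity (R : realType) (m n : nat) (A : 'M[R]_(m, n)) : nat :=
  \rank (cokermx A).

Definition del_row_col (R : realType) (n : nat) (i : 'I_n) (A : 'M[R]_n) :
    'M[R]_n.-1 := row' i (col' i A).

Definition nullity_pair (R : realType) (n : nat) (i : 'I_n) (A : 'M[R]_n) :
    nat * nat := (nullity A, nullity (del_row_col i A)).

Definition SNIP (R : realType) (n : nat) (i : 'I_n) (A : 'M[R]_n) : Prop :=
  forall X : 'M[R]_n, symmetric_mx X ->
    hadamard A X = 0 -> hadamard 1%:M X = 0 -> row' i (A *m X) = 0 -> X = 0.

(* Submultiplicativity is not required, so this covers both usages of
   "matrix norm"; nonnegativity follows from the three axioms. *)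
Record matrix_norm (R : realType) (n : nat) (N : 'M[R]_n -> R) : Prop := {
  matrix_norm_definite : forall A, N A = 0 -> A = 0;
  matrix_norm_scale : forall (a : R) A, N (a *: A) = `|a| * N A;
  matrix_norm_triangle : forall A B, N (A + B) <= N A + N B
}.

(* Main.v *)
(** Let D be the identity matrix with its (i, i) entry cleared. The congruences
    A' = (1 + K)^T A (1 + K) with K = D A X small keep the i-nullity pair, since
    row i of K vanishes and so A'(i) is itself a congruence of A(i). Take X
    symmetric and supported on the non-edges of G. The non-edge entries of A' are
    a quadratic function of X whose linear part, X |-> X B + B X with B = A D A,
    is injective: pairing it with X gives twice the squared Frobenius norm of
    D A X, and the i-SNIP turns D A X = 0 into X = 0. Being an injective
    endomorphism it is invertible, and the contraction principle yields small X
    for which A' takes any prescribed small values on the non-edges of G: 0 on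
    the non-edges of H, some t > 0 on the new edges. The same inverse bounds X
    by D A X, which makes the i-SNIP an open condition. *)
From HB Require Import structures.
Require Import Defs.
From mathcomp Require Import all_boot all_order all_algebra.
From mathcomp Require Import all_classical reals.
From mathcomp Require Import interval_inference topology normedtype sequences.
From mathcomp Require Import ring lra.
Set Implicit Arguments.
Unset Strict Implicit.
Unset Printing Implicit Defensive.
Import Order.TTheory GRing.Theory Num.Theory.
Import numFieldNormedType.Exports.
Local Open Scope classical_set_scope.
Local Open Scope ring_scope.

(** Joins the complete and the normed structures on matrices, as [banach_fixed_point] requires. *)
HB.instance Definition _ (R : realType) m n := Complete.on 'M[R]_(m, n).

(** * The entrywise l1 norm and a fixed-point principle *)

Section L1Norm.
Variable R : realType.

(** This norm is submultiplicative, invariant under transposition and does not grow when entries are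
    erased. The entrywise maximum norm [|X|] is not submultiplicative in general; it serves only for
    the topology. *)
Definition l1norm m n (X : 'M[R]_(m, n)) : R := \sum_j \sum_k `|X j k|.

Lemma l1norm_ge0 m n (X : 'M[R]_(m, n)) : 0 <= l1norm X.
Proof. by apply: sumr_ge0 => j _; apply: sumr_ge0. Qed.

Lemma l1norm_entry m n (X : 'M[R]_(m, n)) j k : `|X j k| <= l1norm X.
Proof.
rewrite /l1norm (bigD1 j) //= (bigD1 k) //= -addrA lerDl addr_ge0 //.
  exact: sumr_ge0.
by apply: sumr_ge0 => l _; apply: sumr_ge0.
Qed.

Lemma l1norm_le0 m n (X : 'M[R]_(m, n)) : l1norm X <= 0 -> X = 0.
Proof.
move=> X0; apply/matrixP => j k; rewrite mxE; apply/eqP.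
by rewrite -normr_le0 (le_trans (l1norm_entry X j k)).
Qed.

Lemma l1normD m n (X Y : 'M[R]_(m, n)) : l1norm (X + Y) <= l1norm X + l1norm Y.
Proof.
rewrite /l1norm -big_split ler_sum //= => j _; rewrite -big_split ler_sum //= => k _.
by rewrite mxE ler_normD.
Qed.

Lemma l1normN m n (X : 'M[R]_(m, n)) : l1norm (- X) = l1norm X.
Proof. by apply: eq_bigr => j _; apply: eq_bigr => k _; rewrite mxE normrN. Qed.

Lemma l1normZ m n a (X : 'M[R]_(m, n)) : l1norm (a *: X) = `|a| * l1norm X.
Proof.
rewrite /l1norm mulr_sumr; apply: eq_bigr => j _; rewrite mulr_sumr.
by apply: eq_bigr => k _; rewrite mxE normrM.
Qed.

Lemma l1norm_tr m n (X : 'M[R]_(m, n)) : l1norm X^T = l1norm X.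
Proof.
rewrite /l1norm exchange_big; apply: eq_bigr => j _; apply: eq_bigr => k _.
by rewrite mxE.
Qed.

Lemma l1normM m n p (X : 'M[R]_(m, n)) (Y : 'M[R]_(n, p)) :
  l1norm (X *m Y) <= l1norm X * l1norm Y.
Proof.
rewrite /l1norm mulr_suml ler_sum // => j _.
apply: (@le_trans _ _ (\sum_l `|X j l| * \sum_k `|Y l k|)).
  under [leRHS]eq_bigr do rewrite mulr_sumr.
  rewrite exchange_big ler_sum //= => k _; rewrite mxE.
  by under [leRHS]eq_bigr do rewrite -normrM; exact: ler_norm_sum.
rewrite mulr_suml ler_sum // => l _; rewrite ler_wpM2l // (bigD1 l) //= lerDl.
by apply: sumr_ge0 => ? _; apply: sumr_ge0.
Qed.

Lemma l1norm_del_row_col n (i : 'I_n) (X : 'M[R]_n) :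
  l1norm (row' i (col' i X)) <= l1norm X.
Proof.
rewrite /l1norm [leRHS](bigD1_ord i) //= -[leLHS]add0r lerD ?sumr_ge0 //.
apply: ler_sum => j _; rewrite [leRHS](bigD1_ord i) //= -[leLHS]add0r lerD //.
by apply: ler_sum => k _; rewrite !mxE.
Qed.

(** Expand [X] over the matrix units. This is applied to the given norm and to [l1norm] composed
    with an inverse linear map. *)
Lemma seminorm_bounded m n (p : 'M[R]_(m, n) -> R) :
  (forall a X, p (a *: X) = `|a| * p X) ->
  (forall X Y, p (X + Y) <= p X + p Y) ->
  exists2 c, 0 <= c & forall X, p X <= c * l1norm X.
Proof.
move=> pZ pD.
have p0 : p 0 = 0 by rewrite -(scale0r 0) pZ normr0 mul0r.
have pge0 X : 0 <= p X.
  have := pD X (-1 *: X); rewrite pZ normrN1 mul1r scaleN1r subrr p0; lra.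
have psum (I : finType) (F : I -> 'M[R]_(m, n)) : p (\sum_i F i) <= \sum_i p (F i).
  elim/big_ind2: _ => [|x1 x2 y1 y2 h1 h2|//]; first by rewrite p0.
  by rewrite (le_trans (pD _ _)) // lerD.
exists (\sum_j \sum_k p (delta_mx j k)) => [|X].
  by apply: sumr_ge0 => j _; apply: sumr_ge0.
rewrite [X in p X]matrix_sum_delta (le_trans (psum _ _)) //.
rewrite /l1norm mulr_sumr ler_sum // => j _; rewrite (le_trans (psum _ _)) //.
rewrite mulr_sumr ler_sum // => k _; rewrite pZ mulrC ler_wpM2r //.
rewrite (bigD1 j) //= (bigD1 k) //= -addrA lerDl addr_ge0 // sumr_ge0 // => l _.
exact: sumr_ge0.
Qed.

(** A row [v] with [v *m (1 + K) = 0] equals [- v *m K], whose norm is below that of [v] unless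
    [v = 0]. *)
Lemma unitmx_1D n (K : 'M[R]_n) : l1norm K < 1 -> 1%:M + K \in unitmx.
Proof.
move=> K1; rewrite -row_free_unit -kermx_eq0; apply/rowV0P => v /sub_kermxP.
rewrite mulmxDr mulmx1 => /eqP; rewrite addr_eq0 => /eqP vE.
apply: l1norm_le0; have := l1normM v K; rewrite -[l1norm (v *m K)]l1normN -vE.
have := l1norm_ge0 v; nra.
Qed.

Lemma normr_le_l1norm m n (X : 'M[R]_(m, n)) : `|X| <= l1norm X.
Proof.
rewrite [leLHS]/Num.norm /= mx_normrE; apply: bigmax_le => [|[j k] _].
  exact: l1norm_ge0.
exact: l1norm_entry.
Qed.

Lemma l1norm_le_normr m n (X : 'M[R]_(m, n)) : l1norm X <= (m * n)%:R * `|X|.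
Proof.
have Xjk j k : `|X j k| <= `|X|.
  rewrite [leRHS]/Num.norm /= mx_normrE.
  exact: (le_bigmax _ (fun p : 'I_m * 'I_n => `|X p.1 p.2|) (j, k)).
apply: (@le_trans _ _ (\sum_(j < m) \sum_(k < n) `|X|)).
  by apply: ler_sum => j _; apply: ler_sum.
by rewrite !sumr_const !card_ord -mulrnA mulr_natl mulnC.
Qed.

(** On a ball the Lipschitz constant of [g] is proportional to the radius, so [X |-> Y + g X] is a
    contraction of a small enough ball. *)
Lemma quadratic_fixed_point n (g : 'M[R]_n -> 'M[R]_n) (c d : R) :
  0 <= c -> 0 < d -> g 0 = 0 ->
  (forall X Y, l1norm (g X - g Y) <= c * (l1norm X + l1norm Y) * l1norm (X - Y)) ->
  exists2 t, 0 < t & forall Y, l1norm Y <= t ->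
    exists2 X, l1norm X < d & X = Y + g X.
Proof.
move=> c0 d0 g0 gL.
(* The successor keeps [s] positive when [n = 0]. *)
pose s : R := (n * n).+1%:R.
have s0 : 0 < s by rewrite ltr0n.
have l1N (X : 'M[R]_n) : l1norm X <= s * `|X|.
  by rewrite (le_trans (l1norm_le_normr X)) // ler_wpM2r // ler_nat leqnSn.
(* The first summand makes the Lipschitz constant at most 1/2 ([r_lip]), the second puts the ball
   within [l1norm] distance [d] of 0 ([r_d]). *)
pose r := (4 * (c + 1) * s * s + 2 * s / d)^-1.
have sd0 : 0 < s / d by rewrite divr_gt0.
have css0 : 0 <= c * s * s by rewrite !mulr_ge0 // ltW.
have ss0 : 0 < s * s by rewrite mulr_gt0.
have den0 : 0 < 4 * (c + 1) * s * s + 2 * s / d by nra.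
have r0 : 0 < r by rewrite invr_gt0.
have rden : r * (4 * (c + 1) * s * s + 2 * s / d) = 1 by rewrite mulVf // gt_eqF.
have r_lip : c * (2 * s * r) * s <= 1 / 2.
  have : 0 <= r * (s / d) by rewrite mulr_ge0 // ltW.
  have : 0 <= r * (s * s) by rewrite mulr_ge0 // ltW.
  nra.
have r_d : s * r < d.
  have : 2 * (r * (s / d)) <= 1.
    have : 0 <= r * (s * s) by rewrite mulr_ge0 // ltW.
    have : 0 <= r * (c * s * s) by rewrite mulr_ge0 // ltW.
    nra.
  have -> : r * (s / d) = s * r / d by ring.
  by rewrite mulrA ler_pdivrMr // => h; nra.
have gN X Y : `|X| <= r -> `|Y| <= r -> `|g X - g Y| <= 1 / 2 * `|X - Y|.
  move=> Xr Yr; apply: le_trans (normr_le_l1norm _) _.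
  apply: le_trans (gL _ _) _.
  have nX : l1norm X <= s * r by rewrite (le_trans (l1N _)) // ler_wpM2l // ltW.
  have nY : l1norm Y <= s * r by rewrite (le_trans (l1N _)) // ler_wpM2l // ltW.
  apply: (@le_trans _ _ (c * (2 * s * r) * (s * `|X - Y|))).
    apply: ler_pM; rewrite ?l1norm_ge0 ?l1N //.
      by rewrite mulr_ge0 // addr_ge0 // l1norm_ge0.
    by rewrite ler_wpM2l //; lra.
  by rewrite mulrA ler_wpM2r.
(* Since [g 0 = 0], [g] maps the ball of radius [r] into that of radius [r / 2]; [Y] may use the
   other half. *)
exists (r / 2) => [|Y Yr]; first by rewrite divr_gt0.
pose f X := Y + g X.
pose U : set 'M[R]_n := [set X | `|X| <= r].
have fU : set_fun U U f.
  move=> X XU; rewrite /U /f /=; have := gN X 0 XU; rewrite normr0 g0 !subr0 => h.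
  apply: le_trans (ler_normD _ _) _; have := h (ltW r0).
  have := le_trans (normr_le_l1norm Y) Yr; have : `|X| <= r by []. lra.
pose F := @mkfun _ _ U U f fU.
have ctr : is_contraction F.
  exists (1 / 2)%:nng; split; first by rewrite /=; lra.
  move=> [X Z] [/= XU ZU]; rewrite /F /= /f opprD addrACA subrr add0r.
  by have := gN _ _ XU ZU.
have Ucl : closed U.
  apply: (@closed_comp _ _ (@Num.norm _ 'M[R]_n) [set x | x <= r]).
    by move=> X _; exact: norm_continuous.
  exact: closed_le.
have U0 : U !=set0 by exists 0; rewrite /U /= normr0 ltW.
have [X XU XE] := banach_fixed_point ctr Ucl U0.
exists X; last exact: XE.
by rewrite (le_lt_trans (l1N _)) // (le_lt_trans _ r_d) // ler_wpM2l // ltW.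
Qed.

End L1Norm.

(** * Linear inverses, Gram matrices and congruences *)

Section LinearAlgebra.
Variable R : realType.

(** In [mxvec] coordinates [f] is a square matrix with trivial kernel, hence invertible. *)
Lemma injective_linear_inverse m n (f : {linear 'M[R]_(m, n) -> 'M[R]_(m, n)}) :
  (forall X, f X = 0 -> X = 0) ->
  exists g : {linear 'M[R]_(m, n) -> 'M[R]_(m, n)}, cancel f g /\ cancel g f.
Proof.
move=> f_inj.
have fU : lin_mx f \in unitmx.
  rewrite -row_free_unit -kermx_eq0; apply/rowV0P => v /sub_kermxP.
  rewrite -[v]vec_mxK mul_vec_lin => /(congr1 (@vec_mx _ _ _)).
  by rewrite mxvecK linear0 => /f_inj->; rewrite linear0.
pose g : {linear 'M[R]_(m, n) -> 'M[R]_(m, n)} :=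
  vec_mx \o mulmxr (invmx (lin_mx f)) \o mxvec.
exists g; split=> X /=.
  by rewrite -mul_vec_lin mulmxK // mxvecK.
apply: (can_inj mxvecK); rewrite -mul_vec_lin vec_mxK mulmxKV //.
Qed.

(** The trace is the sum of the squared entries of [M]. *)
Lemma mxtrace_gram_eq0 m n (M : 'M[R]_(m, n)) : \tr (M^T *m M) = 0 -> M = 0.
Proof.
have trE : \tr (M^T *m M) = \sum_k \sum_j M j k ^+ 2.
  apply: eq_bigr => k _; rewrite mxE.
  by apply: eq_bigr => j _; rewrite mxE expr2.
rewrite trE => /eqP; rewrite psumr_eq0 => [/allP M0|k _]; last first.
  by apply: sumr_ge0 => j _; exact: sqr_ge0.
apply/matrixP => j k; rewrite mxE; apply/eqP.
have /implyP/(_ isT) := M0 k (mem_index_enum k).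
rewrite psumr_eq0 => [/allP/(_ j (mem_index_enum j))|l _]; last exact: sqr_ge0.
by rewrite sqrf_eq0.
Qed.

Lemma nullityE m n (A : 'M[R]_(m, n)) : nullity A = (n - \rank A)%N.
Proof. by rewrite /nullity mxrank_coker. Qed.

Lemma mxrank_congruence n (Q A : 'M[R]_n) :
  Q \in unitmx -> \rank (Q^T *m A *m Q) = \rank A.
Proof.
move=> Qu; rewrite mxrankMfree ?row_free_unit // -mxrank_tr trmx_mul trmxK.
by rewrite mxrankMfree ?row_free_unit // mxrank_tr.
Qed.

Lemma row'_mul m n p (i : 'I_m) (A : 'M[R]_(m, n)) (B : 'M[R]_(n, p)) :
  row' i (A *m B) = row' i A *m B.
Proof. by apply/matrixP => j k; rewrite !mxE; apply: eq_bigr => l _; rewrite !mxE. Qed.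

Lemma col'_mul m n p (i : 'I_p) (A : 'M[R]_(m, n)) (B : 'M[R]_(n, p)) :
  col' i (A *m B) = A *m col' i B.
Proof. by apply/matrixP => j k; rewrite !mxE; apply: eq_bigr => l _; rewrite !mxE. Qed.

Lemma mulmx_row0 m n p (i : 'I_n) (A : 'M[R]_(m, n)) (B : 'M[R]_(n, p)) :
  row i B = 0 -> A *m B = col' i A *m row' i B.
Proof.
move=> /rowP B0; apply/matrixP => j k; rewrite !mxE (bigD1_ord i) //=.
have := B0 k; rewrite !mxE => ->; rewrite mulr0 add0r.
by apply: eq_bigr => l _; rewrite !mxE.
Qed.

(** Row [i] of [1 + K] is zero off the diagonal, so deleting index [i] commutes with the congruence;
    both congruence factors are small perturbations of the identity, hence invertible. *)
Lemma nullity_pair_congruence n (i : 'I_n) (A K : 'M[R]_n) :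
  row i K = 0 -> l1norm K < 1 ->
  nullity_pair i ((1%:M + K)^T *m A *m (1%:M + K)) = nullity_pair i A.
Proof.
move=> Ki K1; set Q := 1%:M + K.
have Qi : row i (col' i Q) = 0.
  apply/rowP => k; rewrite !mxE (negbTE (neq_lift i k)) add0r.
  by have /rowP/(_ (lift i k)) := Ki; rewrite !mxE.
have QiE : row' i (col' i Q) = 1%:M + row' i (col' i K).
  by apply/matrixP => j k; rewrite !mxE (inj_eq (@lift_inj _ i)).
have delE : del_row_col i (Q^T *m A *m Q) =
    (row' i (col' i Q))^T *m del_row_col i A *m row' i (col' i Q).
  rewrite /del_row_col col'_mul row'_mul (mulmx_row0 (i := i)) //.
  congr (_ *m _).
  (* Transposing turns [row' i Q^T] into [col' i Q], whose row [i] vanishes. *)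
  rewrite row'_mul col'_mul; apply: trmx_inj.
  by rewrite !trmx_mul trmxK !tr_row' trmxK (mulmx_row0 (i := i)).
rewrite /nullity_pair !nullityE delE !mxrank_congruence ?unitmx_1D //.
by rewrite QiE unitmx_1D // (le_lt_trans (l1norm_del_row_col i K)).
Qed.

End LinearAlgebra.

(** * Matrices supported on the non-edges of a graph *)

Section NonEdges.
Variables (R : realType) (n : nat) (G : simple_graph n).
Implicit Types X Y : 'M[R]_n.

(** With the diagonal excluded, [nonedge_part X = X] captures both Hadamard conditions of the SNIP
    at once. *)
Definition nonedge (j k : 'I_n) : bool := (j != k) && ~~ adj G j k.

Definition nonedge_part X : 'M[R]_n :=
  \matrix_(j, k) (X j k *+ nonedge j k).

Lemma nonedge_part_is_linear : linear nonedge_part.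
Proof.
by move=> a X Y; apply/matrixP => j k; rewrite !mxE mulrnDl mulrnAr.
Qed.
HB.instance Definition _ :=
  GRing.isLinear.Build R 'M[R]_n 'M[R]_n _ nonedge_part nonedge_part_is_linear.

Lemma nonedge_sym j k : nonedge j k = nonedge k j.
Proof. by rewrite /nonedge eq_sym adj_sym. Qed.

Lemma tr_nonedge_part X : (nonedge_part X)^T = nonedge_part X^T.
Proof. by apply/matrixP => j k; rewrite !mxE nonedge_sym. Qed.

Lemma nonedge_partK X : nonedge_part (nonedge_part X) = nonedge_part X.
Proof. by apply/matrixP => j k; rewrite !mxE; case: nonedge. Qed.

Lemma l1norm_nonedge_part X : l1norm (nonedge_part X) <= l1norm X.
Proof.
apply: ler_sum => j _; apply: ler_sum => k _.
by rewrite mxE; case: nonedge; rewrite // mulr0n normr0.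
Qed.

Lemma graph_matrices_nonedge_part X : graph_matrices G X -> nonedge_part X = 0.
Proof.
case=> _ XG; apply/matrixP => j k; rewrite !mxE.
case: (boolP (nonedge j k)) => // /andP[jk njk]; rewrite mulr1n.
by apply/eqP; apply: contraNT njk => /eqP/(XG _ _ jk).
Qed.

Lemma nonedge_part_hadamard X Y : graph_matrices G X ->
  hadamard X Y = 0 -> hadamard 1%:M Y = 0 -> nonedge_part Y = Y.
Proof.
case=> _ XG /matrixP XY /matrixP IY; apply/matrixP => j k; rewrite !mxE /nonedge.
have [<-|jk] := eqVneq j k.
  by have := IY j j; rewrite !mxE eqxx mul1r => ->; rewrite mul0rn.
have [/(XG _ _ jk) Xjk|//] := boolP (adj G j k).
have /eqP := XY j k; rewrite !mxE mulf_eq0 => /orP[/eqP//|/eqP->].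
by rewrite mul0rn.
Qed.

Lemma hadamard_nonedge_part X Y : graph_matrices G X -> nonedge_part Y = Y ->
  hadamard X Y = 0 /\ hadamard 1%:M Y = 0.
Proof.
move=> XG YE; have /matrixP X0 := graph_matrices_nonedge_part XG.
rewrite -YE; split; apply/matrixP => j k; have := X0 j k; rewrite !mxE.
  by case: nonedge; rewrite ?mulr0 // !mulr1n => ->; rewrite mul0r.
by rewrite /nonedge; case: eqVneq; rewrite ?mul0r // mulr0.
Qed.

(** [nonedge_part] is an orthogonal projection for the Frobenius inner product [\tr (X^T *m Y)]. *)
Lemma mxtrace_nonedge_part X Y : nonedge_part X = X ->
  \tr (X^T *m Y) = \tr (X^T *m nonedge_part Y).
Proof.
move=> <-; apply: eq_bigr => k _; rewrite !mxE; apply: eq_bigr => j _.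
by rewrite !mxE; case: nonedge; rewrite // !mul0r.
Qed.

End NonEdges.

(** * Inverting the linear part, solving for X, and stability of the SNIP *)

Section Perturbation.
Variables (R : realType) (n : nat) (G : simple_graph n) (i : 'I_n) (A : 'M[R]_n).
Hypotheses (AG : graph_matrices G A) (A_SNIP : SNIP i A).
Implicit Types X Y : 'M[R]_n.

Local Notation P := (nonedge_part G).

(** Clearing row [i] rather than deleting it keeps all matrices square, and makes the operation a
    symmetric idempotent factor. *)
Definition row_eraser : 'M[R]_n := \matrix_(j, k) ((j == k) && (j != i))%:R.

Local Notation D := row_eraser.

Lemma row_eraser_mulE m (M : 'M[R]_(n, m)) j k :
  (row_eraser *m M) j k = if j == i then 0 else M j k.
Proof.
rewrite mxE (bigD1 j) //= big1 => [|l lj]; last first.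
  by rewrite mxE eq_sym (negbTE lj) mul0r.
by rewrite mxE eqxx addr0; case: eqP => _; rewrite ?mul0r ?mul1r.
Qed.

Lemma tr_row_eraser : row_eraser^T = row_eraser.
Proof. by apply/matrixP => j k; rewrite !mxE eq_sym; case: eqP => // ->. Qed.

Lemma row_eraser_idem : row_eraser *m row_eraser = row_eraser.
Proof.
apply/matrixP => j k; rewrite row_eraser_mulE !mxE.
by case: (j == i); rewrite // andbF.
Qed.

Lemma row'_eq0 m (M : 'M[R]_(n, m)) : row' i M = 0 <-> row_eraser *m M = 0.
Proof.
split=> /matrixP M0; apply/matrixP => j k.
  rewrite row_eraser_mulE mxE; case: (unliftP i j) => [l ->|->]; last by rewrite eqxx.
  by have := M0 l k; rewrite !mxE => ->; case: eqP.
have := M0 (lift i j) k.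
by rewrite row_eraser_mulE !mxE eq_sym (negbTE (neq_lift i j)).
Qed.

Let At : A^T = A. Proof. by case: AG. Qed.
Let Dt : D^T = D. Proof. exact: tr_row_eraser. Qed.

(** Projecting onto the symmetric matrices lets the maps below be defined on all matrices. *)
Definition sym_part X : 'M[R]_n := 2^-1 *: (X + X^T).

Lemma sym_part_is_linear : linear sym_part.
Proof.
move=> a X Y; rewrite /sym_part linearP /= scalerA mulrC -scalerA -scalerDr.
by rewrite [a *: (_ + _)]scalerDr addrACA.
Qed.
HB.instance Definition _ :=
  GRing.isLinear.Build R 'M[R]_n 'M[R]_n _ sym_part sym_part_is_linear.

Lemma tr_sym_part X : (sym_part X)^T = sym_part X.
Proof. by rewrite /sym_part linearZ /= linearD /= trmxK addrC. Qed.

Lemma sym_part_id X : X^T = X -> sym_part X = X.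
Proof. by move=> Xt; rewrite /sym_part Xt; apply/matrixP => j k; rewrite !mxE; field. Qed.

Lemma l1norm_sym_part X : l1norm (sym_part X) <= l1norm X.
Proof.
rewrite /sym_part l1normZ ger0_norm ?invr_ge0 //.
have := l1normD X X^T; rewrite l1norm_tr; lra.
Qed.

(* The linear part, at X = 0, of the congruence of A by 1 + D A X. *)
Definition lin_part X : 'M[R]_n :=
  nonedge_part G (X *m (A *m row_eraser *m A) + A *m row_eraser *m A *m X).

Lemma lin_part_injective X : X^T = X -> P X = X -> lin_part X = 0 -> X = 0.
Proof.
move=> Xt PX L0.
suff DAX : D *m (A *m X) = 0.
  have [? ?] := hadamard_nonedge_part AG PX.
  by apply: A_SNIP => //; apply/row'_eq0.
apply: mxtrace_gram_eq0.
have : \tr (X^T *m (X *m (A *m D *m A) + A *m D *m A *m X)) = 0.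
  by rewrite (mxtrace_nonedge_part _ PX) -/(lin_part X) L0 mulmx0 mxtrace0.
(* By cyclicity both terms have the trace of [X *m (A *m D *m A) *m X], which is a Gram matrix
   because [D] is a symmetric idempotent. *)
rewrite Xt mulmxDr mxtraceD mxtrace_mulC [X *m (_ *m X)]mulmxA.
have -> : X *m (A *m D *m A) *m X = (D *m (A *m X))^T *m (D *m (A *m X)).
  by rewrite !trmx_mul Dt At Xt !mulmxA -[X *m A *m D *m D]mulmxA row_eraser_idem.
by move=> h; lra.
Qed.

(* [lin_part] on the symmetric matrices supported on non-edges, extended by
   the identity on a complement so as to be invertible on all matrices. *)
Definition ext_lin_part X : 'M[R]_n :=
  lin_part (sym_part X) + (X - nonedge_part G (sym_part X)).

Lemma ext_lin_part_is_linear : linear ext_lin_part.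
Proof.
have PP := nonedge_part_is_linear G; move=> a X Y.
rewrite /ext_lin_part /lin_part sym_part_is_linear mulmxDl mulmxDr.
rewrite -scalemxAl -scalemxAr addrACA -scalerDr !PP.
by apply/matrixP => j k; rewrite !mxE; ring.
Qed.
HB.instance Definition _ :=
  GRing.isLinear.Build R 'M[R]_n 'M[R]_n _ ext_lin_part ext_lin_part_is_linear.

Lemma tr_lin_part X : X^T = X -> (lin_part X)^T = lin_part X.
Proof.
move=> Xt; rewrite /lin_part tr_nonedge_part linearD /= !trmx_mul At Dt Xt.
by rewrite addrC !mulmxA.
Qed.

(** [X] differs from its image by matrices that are symmetric and supported on non-edges, so it
    inherits both properties from the image; the complementary term then vanishes. *)
Lemma ext_lin_part_range X : (ext_lin_part X)^T = ext_lin_part X ->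
  P (ext_lin_part X) = ext_lin_part X ->
  [/\ X^T = X, P X = X & lin_part X = ext_lin_part X].
Proof.
move=> Wt PW; set W := ext_lin_part X in Wt PW *.
have XE : X = W - lin_part (sym_part X) + P (sym_part X).
  by rewrite /W /ext_lin_part; apply/matrixP => j k; rewrite !mxE; ring.
have Xt : X^T = X.
  rewrite XE linearD linearB /= Wt tr_lin_part ?tr_sym_part //.
  by rewrite tr_nonedge_part tr_sym_part.
have PX : P X = X.
  rewrite XE linearD linearB /= PW nonedge_partK.
  by rewrite /lin_part nonedge_partK.
by split; rewrite // /W /ext_lin_part sym_part_id // PX subrr addr0.
Qed.

Lemma ext_lin_part_inverse :
  exists g : {linear 'M[R]_n -> 'M[R]_n},
    cancel ext_lin_part g /\ cancel g ext_lin_part.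
Proof.
apply: injective_linear_inverse => X /= X0.
have [] := @ext_lin_part_range X; rewrite ?X0 ?linear0 //.
exact: lin_part_injective.
Qed.

(** Applying the inverse [h] of [ext_lin_part] turns the equation into [X = h (t *: V) - h (q X)],
    with [q] quadratic. *)
Lemma lin_part_solvable (V : 'M[R]_n) (d : R) : V^T = V -> P V = V -> 0 < d ->
  exists t X, [/\ 0 < t, X^T = X, l1norm X < d &
    P (X *m (A *m D *m A) + A *m D *m A *m X +
       X *m (A *m D *m A *m D *m A) *m X) = t *: V].
Proof.
move=> Vt PV d0; have [h [_ hK]] := ext_lin_part_inverse.
have [||k k0 hN] := @seminorm_bounded R n n (fun X => l1norm (h X)).
- by move=> a X; rewrite linearZ l1normZ.
- by move=> X Y; rewrite linearD l1normD.
set C := A *m D *m A *m D *m A.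
(* Symmetrizing makes [q X] symmetric before the fixed point is known to be so. *)
pose q X := P (sym_part X *m C *m sym_part X).
have qt X : (q X)^T = q X.
  by rewrite /q /C tr_nonedge_part !trmx_mul tr_sym_part At Dt !mulmxA.
have [||||t0 t00 fixP] :=
  @quadratic_fixed_point R n (fun X => - h (q X)) (k * l1norm C) d.
- by rewrite mulr_ge0 // l1norm_ge0.
- exact: d0.
- by rewrite /q linear0 mul0mx mul0mx !linear0.
- move=> X Y; rewrite opprK addrC -linearB /=.
  apply: le_trans (hN _) _; rewrite -!mulrA ler_wpM2l //.
  rewrite -l1normN opprB /q -linearB /=; apply: le_trans (l1norm_nonedge_part _ _) _.
  set x := sym_part X; set y := sym_part Y.
  have -> : x *m C *m x - y *m C *m y = x *m C *m (x - y) + (x - y) *m C *m y.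
    by rewrite mulmxBr !mulmxBl addrA subrK.
  have xyN : l1norm (x - y) <= l1norm (X - Y).
    by rewrite /x /y -linearB l1norm_sym_part.
  apply: le_trans (l1normD _ _) _.
  have M3 (a b c : 'M[R]_n) : l1norm (a *m b *m c) <= l1norm a * l1norm b * l1norm c.
    by rewrite (le_trans (l1normM _ _)) // ler_wpM2r ?l1norm_ge0 // l1normM.
  have -> : l1norm C * ((l1norm X + l1norm Y) * l1norm (X - Y)) =
    l1norm X * l1norm C * l1norm (X - Y) + l1norm (X - Y) * l1norm C * l1norm Y by ring.
  apply: lerD; apply: le_trans (M3 _ _ _) _.
    by rewrite !ler_pM ?mulr_ge0 ?l1norm_ge0 ?l1norm_sym_part.
  by rewrite !ler_pM ?mulr_ge0 ?l1norm_ge0 ?l1norm_sym_part.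
have kV0 : 0 <= k * l1norm V by rewrite mulr_ge0 ?l1norm_ge0.
(* This gives [k * l1norm (t *: V) <= t0]; the added 1 keeps the denominator positive. *)
pose t := t0 / (k * l1norm V + 1).
have t_gt0 : 0 < t by rewrite divr_gt0 //; lra.
have [|X Xd XE] := fixP (h (t *: V)).
  apply: le_trans (hN _) _; rewrite l1normZ gtr0_norm // mulrCA.
  rewrite /t mulrAC ler_pdivrMr; nra.
(* The image of the fixed point is symmetric and supported on non-edges, hence so is [X]. *)
have extX : ext_lin_part X = t *: V - q X by rewrite [in LHS]XE -linearB hK.
have [||Xt PX linX] := @ext_lin_part_range X.
- by rewrite extX linearB linearZ /= Vt qt.
- by rewrite extX linearB linearZ /= PV nonedge_partK.
exists t, X; split=> //.
rewrite linearD /= -/(lin_part X) linX extX.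
by rewrite /q sym_part_id // subrK.
Qed.

Lemma l1norm_row_eraser m (M : 'M[R]_(n, m)) : l1norm (D *m M) <= l1norm M.
Proof.
apply: ler_sum => j _; apply: ler_sum => k _.
by rewrite row_eraser_mulE; case: eqP; rewrite // normr0.
Qed.

(** [X] is the image under [h] of [lin_part X], the non-edge part of [Z^T *m A + A *m Z] with
    [Z = D *m (A *m X)]. *)
Lemma SNIP_bound : exists2 k, 0 <= k &
  forall X, X^T = X -> P X = X -> l1norm X <= k * l1norm (D *m (A *m X)).
Proof.
have [h [hK _]] := ext_lin_part_inverse.
have [||k k0 hN] := @seminorm_bounded R n n (fun X => l1norm (h X)).
- by move=> a X; rewrite linearZ l1normZ.
- by move=> X Y; rewrite linearD l1normD.
exists (k * (2 * l1norm A)) => [|X Xt PX].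
  by rewrite !mulr_ge0 ?l1norm_ge0.
rewrite -[X in l1norm X]hK (le_trans (hN _)) // -mulrA ler_wpM2l //.
rewrite /ext_lin_part sym_part_id // PX subrr addr0.
apply: le_trans (l1norm_nonedge_part _ _) _; apply: le_trans (l1normD _ _) _.
have -> : X *m (A *m D *m A) = (D *m (A *m X))^T *m A.
  by rewrite !trmx_mul Dt At Xt !mulmxA.
have -> : A *m D *m A *m X = A *m (D *m (A *m X)) by rewrite !mulmxA.
have := l1normM (D *m (A *m X))^T A; have := l1normM A (D *m (A *m X)).
rewrite l1norm_tr; lra.
Qed.

(** A test matrix [X] for [A'] is supported on non-edges of [H], hence of [G]. From
    [D *m (A' *m X) = 0], [SNIP_bound] gives [l1norm X <= k * l1norm (A' - A) * l1norm X], forcing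
    [X = 0]. *)
Lemma SNIP_stable (H : simple_graph n) : spanning_subgraph G H ->
  exists2 k, 0 <= k & forall A', graph_matrices H A' ->
    k * l1norm (A' - A) < 1 -> SNIP i A'.
Proof.
move=> GH; have [k k0 kP] := SNIP_bound; exists k => // A' A'H A'A X Xt h1 h2.
move=> /row'_eq0 h3; have PHX := nonedge_part_hadamard A'H h1 h2.
have PX : P X = X.
  rewrite -[X]PHX; apply/matrixP => j l; rewrite !mxE /nonedge.
  have [//|jl] := eqVneq j l.
  by have := @GH j l; case: (adj G j l) => [->|]; rewrite ?mulr1n.
apply: l1norm_le0; have := kP X Xt PX.
have -> : D *m (A *m X) = - (D *m ((A' - A) *m X)).
  by rewrite mulmxBl mulmxBr h3 sub0r opprK.
rewrite l1normN.
have := l1norm_row_eraser ((A' - A) *m X); have := l1normM (A' - A) X.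
have := l1norm_ge0 X; have := l1norm_ge0 (A' - A).
move: (l1norm (D *m _)) (l1norm (_ *m X)) (l1norm X) (l1norm _) A'A => a b x e; nra.
Qed.

End Perturbation.

(** * Choice of constants and construction of the perturbed matrix *)

Lemma entries_bounded_below (R : realType) m n (A : 'M[R]_(m, n)) :
  exists2 e, 0 < e & forall j k, A j k != 0 -> e <= `|A j k|.
Proof.
(* The default 1 keeps the bound positive even when [A] is zero. *)
exists (\big[Order.min/1]_(p : 'I_m * 'I_n | A p.1 p.2 != 0) `|A p.1 p.2|).
  by apply: lt_bigmin => // p; rewrite normr_gt0.
by move=> j k Ajk; exact: (bigmin_le_cond _ (fun p => `|A p.1 p.2|) (j := (j, k))).
Qed.

Theorem lemma6p7 (R : realType) (n : nat) (G H : simple_graph n) (i : 'I_n)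
    (N : 'M[R]_n -> R) (A : 'M[R]_n) :
  matrix_norm N ->
  spanning_subgraph G H ->
  graph_matrices G A ->
  SNIP i A ->
  forall eps : R, 0 < eps ->
    exists A' : 'M[R]_n,
      [/\ graph_matrices H A', N (A' - A) < eps,
          nullity_pair i A' = nullity_pair i A & SNIP i A'].
Proof.
move=> [_ NZ ND] GH AG As eps eps0.
have [At AE] := AG.
have [cN cN0 NP] := seminorm_bounded NZ ND.
have [e e0 eP] := entries_bounded_below A.
have [k k0 kP] := SNIP_stable AG As GH.
set D := row_eraser R i.
have Dt : D^T = D := tr_row_eraser R i.
set B := A *m D *m A; set C := A *m D *m A *m D *m A.
(* Once [l1norm X < 1], the two linear terms and the quadratic one give
   [l1norm (A' - A) <= a * l1norm X]. *)
pose a := 2 * l1norm B + l1norm C.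
have a0 : 0 <= a by rewrite addr_ge0 ?mulr_ge0 ?l1norm_ge0.
pose b := Num.min 1 (Num.min eps e).
have b0 : 0 < b by rewrite !lt_min ltr01 eps0 e0.
have [b1 beps be] : [/\ b <= 1, b <= eps & b <= e].
  by rewrite /b !ge_min !lexx !orbT.
(* Each summand handles one smallness condition: [l1norm X < 1], [l1norm K < 1], the distance in
   [N], the edges of [G] staying nonzero, and the SNIP. *)
pose M := 1 + l1norm (D *m A) + cN * a + a + k * a.
have [d0 cNa ka] : [/\ 0 <= l1norm (D *m A), 0 <= cN * a & 0 <= k * a].
  by rewrite l1norm_ge0 !mulr_ge0.
have M0 : 0 < M by rewrite /M; lra.
(* The indicator of the new edges, at which [A'] takes the value [t]. *)
pose V : 'M[R]_n := \matrix_(j, l) (adj H j l && ~~ adj G j l)%:R.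
have Vt : V^T = V by apply/matrixP => j l; rewrite !mxE !(adj_sym _ j).
have PV : nonedge_part G V = V.
  apply/matrixP => j l; rewrite !mxE /nonedge.
  have [<-|_] := eqVneq j l; first by rewrite adj_irrefl.
  by case: (adj G j l); rewrite ?andbF ?mulr1n.
have [|t [X [t0 Xt Xd XE]]] := @lin_part_solvable _ _ _ _ _ AG As V (b / M) Vt PV.
  by rewrite divr_gt0.
rewrite -/D -/B -/C in XE.
have x0 := l1norm_ge0 X.
have xM : M * l1norm X < b by move: Xd; rewrite ltr_pdivlMr // mulrC.
have small c : 0 <= c -> c <= M -> c * l1norm X < b.
  by move=> c0 cM; rewrite (le_lt_trans _ xM) // ler_wpM2r.
have x1 : l1norm X < 1.
  by have := small 1 ler01; rewrite mul1r => h; rewrite (lt_le_trans (h _)) // /M; lra.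
pose K := D *m A *m X.
pose A' := (1%:M + K)^T *m A *m (1%:M + K).
(* By symmetry of [A], [D] and [X]: [K^T *m A = X *m B], [A *m K = B *m X] and
   [K^T *m A *m K = X *m C *m X]. *)
have A'E : A' = A + (X *m B + B *m X + X *m C *m X).
  rewrite /A' /K [(_ + _)^T]linearD /= trmx1 !trmx_mul Xt At Dt.
  by rewrite !mulmxDl !mulmxDr !mul1mx !mulmx1 /B /C !mulmxA !addrA [A + _ + _]addrAC.
have A't : A'^T = A' by rewrite /A' !trmx_mul trmxK At mulmxA.
have A'N : l1norm (A' - A) <= a * l1norm X.
  rewrite A'E addrC addKr.
  apply: le_trans (l1normD _ _) _; have := l1normD (X *m B) (B *m X).
  have := l1normM X B; have := l1normM B X.
  have : l1norm (X *m C *m X) <= l1norm C * l1norm X.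
    rewrite (le_trans (l1normM _ _)) // ler_wpM2r // (le_trans (l1normM _ _)) //.
    by rewrite ler_piMl ?l1norm_ge0 // ltW.
  rewrite /a; lra.
have A'H : graph_matrices H A'.
  split=> // j l jl; have [Gjl|nGjl] := boolP (adj G j l).
    split=> [_|_]; first exact: GH.
    have Ajl : A j l != 0 by apply/eqP/AE.
    (* A vanishing entry would mean a change of at least [e], while [A' - A] has norm below
       [b <= e]. *)
    move=> A'0; have := l1norm_entry (A' - A) j l; rewrite mxE A'0 mxE sub0r normrN.
    apply/negP; rewrite -ltNge (le_lt_trans A'N) //.
    by rewrite (lt_le_trans (small _ _ _) _) ?(le_trans be) ?eP // /M; lra.
  have -> : A' j l = t * (adj H j l)%:R.
    have PE (Y : 'M[R]_n) : nonedge_part G Y j l = Y j l.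
      by rewrite mxE /nonedge jl nGjl.
    rewrite A'E mxE -[A j l]PE (graph_matrices_nonedge_part AG) mxE add0r.
    by rewrite -PE XE !mxE nGjl andbT.
  case: (adj H j l); last by rewrite mulr0.
  by rewrite mulr1; split=> // _; apply/eqP; rewrite gt_eqF.
exists A'; split=> //.
- apply: le_lt_trans (NP _) _; apply: le_lt_trans (ler_wpM2l cN0 A'N) _.
  by rewrite mulrA (lt_le_trans (small _ _ _)) // /M; lra.
- apply: nullity_pair_congruence.
    by apply/rowP => l; rewrite /K -mulmxA mxE row_eraser_mulE eqxx mxE.
  apply: le_lt_trans (l1normM _ _) _.
  by rewrite (lt_le_trans (small _ _ _)) // /M; lra.
- apply: kP => //; apply: le_lt_trans (ler_wpM2l k0 A'N) _.
  by rewrite mulrA (lt_le_trans (small _ _ _)) // /M; lra.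
Qed.
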